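(* For integers $n,k$ with $n\ge 2$ and $1\le k\le 2^{n-1}$, the number $\tau_{n,k}$ of separating families of $k$ arbitrary bipartitions over an $n$-element set is $$\tau_{n,k}=\frac{(n-1)!}{k!}\sum_{i=1}^{k}(-1)^{k-i}\left[{k \atop i}\right]\binom{2^i-1}{n-1}.$$
   Context: A bipartition of a set $S$ is a partition of $S$ into at most two nonempty components (so the trivial partition $\{S\}$ is a bipartition). A bipartition cuts two elements if they lie in different components. A family of bipartitions of $S$ is a separating family for $S$ if every two distinct elements of $S$ are cut by some bipartition in the family. $\tau_{n,k}$ is the number of separating families consisting of $k$ distinct bipartitions of a fixed $n$-element set. $\left[{k \atop i}\right]$ denotes the unsigned Stirling number of the first kind (number of permutations of $k$ elements with exactly $i$ cycles). *)

(* Defs.v *)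
From mathcomp Require Import all_boot all_order all_algebra all_fingroup.

Set Implicit Arguments.
Unset Strict Implicit.
Unset Printing Implicit Defensive.

Section Bipartitions.
Variable T : finType.

(* [partition] already requires the blocks to be nonempty; the trivial
   partition [set [set: T]] is allowed. *)
Definition bipartition (P : {set {set T}}) : bool :=
  partition P [set: T] && (#|P| <= 2).

Definition cuts (P : {set {set T}}) (x y : T) : bool :=
  [exists A in P, exists B in P, [&& A != B, x \in A & y \in B]].

Definition separating_family (F : {set {set {set T}}}) : bool :=
  [forall P in F, bipartition P] &&
  [forall x, forall y, (x != y) ==> [exists P in F, cuts P x y]].

Definition tau (k : nat) : nat :=
  #|[set F : {set {set {set T}}} | separating_family F && (#|F| == k)]|.

End Bipartitions.

(* Fixed points count as cycles: [porbits s] contains their singleton orbits. *)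
Definition stirling1 (k i : nat) : nat :=
  #|[set s : 'S_k | #|porbits s| == i]|.

(* Main.v *)
(* Fix a point x0. A bipartition is determined by its block avoiding x0, so
   k! tau counts the injective separating k-tuples g of subsets avoiding x0.
   The signs of the permutations fixing a tuple g sum to 1 if g is injective and
   to 0 otherwise (pair s with t s, where t swaps two indices of equal value).
   Hence k! tau is the sum over permutations s of the sign of s times the number
   of s-invariant separating k-tuples. Transposing incidence, such a tuple is an
   injection from points to s-invariant sets of indices, sending x0 to the empty
   set; if s has m cycles there are 2^m invariant sets, hence
   (2^m - 1)(2^m - 2)...(2^m - n + 1) tuples. Grouping by m, with sign
   (-1)^(k - m), gives the formula. *)
Require Import Defs.
From mathcomp Require Import all_boot all_order all_algebra all_fingroup.

Set Implicit Arguments.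
Unset Strict Implicit.
Unset Printing Implicit Defensive.

Import GRing.Theory.
Local Open Scope ring_scope.

(** * Signed sums over permutations detect injective tuples *)

Lemma sum_sign_stabilizer (R : numDomainType) (I U : finType)
    (g : {ffun I -> U}) :
  \sum_(s : {perm I} | [forall i, g (s i) == g i]) (-1) ^+ s
    = (injectiveb g)%:R :> R.
Proof.
case: (boolP (injectiveb g)) => [/injectiveP g_inj | /injectivePn[i [j ij gij]]].
  rewrite (big_pred1 1%g) ?odd_perm1 // => s /=; apply/forallP/eqP => [gs | ->].
    by apply/permP => i; rewrite perm1; apply/g_inj/eqP/gs.
  by move=> i; rewrite perm1.
have gt x : g (tperm i j x) = g x by case: tpermP => // ->.
(* Since [R] has characteristic zero, [S == - S] forces [S] to vanish; translation by [tperm i j]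
   preserves the index set and flips every sign. *)
set S := LHS; apply/eqP; suff : S == - S by rewrite -addr_eq0 -mulr2n Num.Theory.mulrn_eq0.
rewrite {1}/S (reindex_inj (mulgI (tperm i j))) /= /S -sumrN.
apply/eqP/eq_big => [s | s _].
  apply/forallP/forallP => gs x; last by rewrite permM (eqP (gs _)) gt.
  by have := gs (tperm i j x); rewrite permM tpermK gt.
rewrite odd_permM odd_tperm ij /=.
by case: (odd_perm s); rewrite ?expr0 ?opprK ?expr1.
Qed.

(** Expand the indicator of injectivity by [sum_sign_stabilizer], then exchange the sums over tuples
    and permutations. *)
Lemma card_injective_signed (R : numDomainType) (I U : finType)
    (Q : pred {ffun I -> U}) :
  #|[set g | Q g & injectiveb g]|%:R =
  \sum_(s : {perm I})
    (-1) ^+ s * #|[set g | Q g & [forall i, g (s i) == g i]]|%:R :> R.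
Proof.
under eq_bigr => s _ do
  rewrite -sum1_card natr_sum mulr_sumr (eq_bigl _ _ (in_set _)).
rewrite (exchange_big_dep Q) /=; last by move=> s g _ /andP[].
rewrite -sum1_card natr_sum (eq_bigl _ _ (in_set _)) big_mkcondr /=.
apply: eq_bigr => g Qg.
rewrite (eq_bigl (fun s : {perm I} => [forall i, g (s i) == g i])).
  under eq_bigr do rewrite mulr1.
  by rewrite sum_sign_stabilizer; case: ifP.
by move=> s; rewrite Qg.
Qed.

(** * Counting the tuples invariant under a permutation *)

Lemma card_perm_invariant_sets (I : finType) (s : {perm I}) :
  #|[set A : {set I} | [forall i, (s i \in A) == (i \in A)]]|
    = (2 ^ #|porbits s|)%N.
Proof.
rewrite -card_powerset.
(* Orbits are disjoint, so a union of orbits contains [x] only if the orbit of [x] was chosen. Hence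
   [cover] is a bijection from sets of orbits to invariant sets. *)
have coverE (P : {set {set I}}) x :
    P \subset porbits s -> (x \in cover P) = (porbit s x \in P).
  move=> /subsetP sP; apply/bigcupP/idP => [[B PB xB] | Px]; last first.
    by exists (porbit s x); rewrite ?porbit_id.
  have /imsetP[y _ eB] := sP B PB.
  by move: xB PB; rewrite eB -eq_porbit_mem => /eqP ->.
rewrite -(card_in_imset (f := @cover I) (D := powerset (porbits s))).
  apply: eq_card => A; rewrite inE; apply/forallP/imsetP => [invA | [P]].
    exists (porbit s @: A).
      by rewrite inE; apply/subsetP => _ /imsetP[x _ ->]; apply: imset_f.
    apply/setP => x; rewrite coverE; last first.
      by apply/subsetP => _ /imsetP[y _ ->]; apply: imset_f.
    apply/idP/imsetP => [xA | [y yA /eqP]]; first by exists x.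
    rewrite eq_porbit_mem => /porbitP[n ->].
    elim: n => [|n IHn]; first by rewrite expg0 perm1.
    by rewrite expgSr permM (eqP (invA _)).
  rewrite inE => sP -> x; rewrite !coverE //.
  by have /eqP-> : porbit s (s x) == porbit s x
    by rewrite eq_porbit_mem -{1}[s]expg1 mem_porbit.
move=> P Q; rewrite !inE => sP sQ ePQ; apply/setP => B.
case: (boolP (B \in porbits s)) => [/imsetP[x _ ->] | nB].
  by rewrite -!coverE // ePQ.
by apply/idP/idP => [/(subsetP sP) | /(subsetP sQ)] BB; rewrite BB in nB.
Qed.

Lemma card_pointed_injections (T U : finType) (x0 : T) (u0 : U) (S : {set U}) :
  u0 \in S ->
  #|[set c : {ffun T -> U} |
      [&& injectiveb c, c x0 == u0 & [forall x, c x \in S]]]|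
    = (#|S|.-1 ^_ #|T|.-1)%N.
Proof.
move=> Su0; pose D := {x : T | x != x0}.
have -> : #|T|.-1 = #|{: D}| by rewrite card_sig -(cardC1 x0); apply: eq_card.
have -> : #|S|.-1 = #|S :\ u0| by rewrite (cardsD1 u0 S) Su0.
rewrite -(card_inj_ffuns_on D (mem (S :\ u0))).
pose restr (c : {ffun T -> U}) : {ffun D -> U} := [ffun y => c (val y)].
rewrite -(card_in_imset (f := restr)); last first.
  move=> c d; rewrite !inE => /and3P[_ /eqP c0 _] /and3P[_ /eqP d0 _] ecd.
  apply/ffunP => x; have [-> | xn] := eqVneq x x0; first by rewrite c0 d0.
  by have /ffunP/(_ (Sub x xn)) := ecd; rewrite !ffunE.
apply: eq_card => d; rewrite inE; apply/imsetP/andP.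
  case=> c; rewrite inE => /and3P[/injectiveP c_inj /eqP c0 /forallP Sc] ->.
  split; last by apply/injectiveP => y z; rewrite !ffunE => /c_inj/val_inj.
  apply/ffun_onP => y; rewrite ffunE !inE Sc andbT -c0 (inj_eq c_inj).
  exact: (valP y).
case=> /ffun_onP dS /injectiveP d_inj.
(* [insub] fails only at [x0], so [c] extends [d] by [u0] there; it stays injective because [d]
   avoids [u0]. *)
pose c : {ffun T -> U} := [ffun x => if insub x is Some y then d y else u0].
have c0 : c x0 = u0 by rewrite ffunE insubF ?eqxx.
have cD (y : D) : c (val y) = d y by rewrite ffunE valK.
exists c; last by apply/ffunP => y; rewrite ffunE cD.
have dS' y : (d y != u0) && (d y \in S) by have := dS y; rewrite !inE.
rewrite inE c0 eqxx /=; apply/andP; split; last first.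
  apply/forallP => x; rewrite ffunE; case: insubP => // y _ _.
  by have /andP[] := dS' y.
apply/injectiveP => x y; rewrite !ffunE.
case: (insubP D x) => [u _ eu|xn]; case: (insubP D y) => [v _ ev|yn].
- by move/d_inj => uv; rewrite -eu -ev uv.
- by move=> e; have := dS' u; rewrite e eqxx.
- by move=> e; have := dS' v; rewrite -e eqxx.
- by move: xn yn; rewrite !negbK => /eqP-> /eqP->.
Qed.

Definition separates (T I : finType) (g : I -> {set T}) : bool :=
  [forall x, forall y, (x != y) ==> [exists i, (x \in g i) != (y \in g i)]].

(** Under transposition, avoiding [x0] becomes the value [set0] at [x0], separation becomes
    injectivity, and invariance of the tuple becomes invariance of every value. *)
Lemma card_separating_invariant (T I : finType) (x0 : T) (s : {perm I}) :
  #|[set g : {ffun I -> {set T}} |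
      [forall i, x0 \notin g i] && separates g
      & [forall i, g (s i) == g i]]|
    = ((2 ^ #|porbits s|).-1 ^_ #|T|.-1)%N.
Proof.
rewrite -card_perm_invariant_sets.
pose S := [set A : {set I} | [forall i, (s i \in A) == (i \in A)]].
have S0 : set0 \in S by rewrite inE; apply/forallP => i; rewrite !inE.
rewrite -/S -(card_pointed_injections x0 S0).
(* [tr] transposes the incidence relation between points and indices. *)
pose tr (A B : finType) (g : {ffun A -> {set B}}) : {ffun B -> {set A}} :=
  [ffun x => [set i | x \in g i]].
have trK A B : cancel (@tr A B) (@tr B A).
  by move=> g; apply/ffunP => i; apply/setP => x; rewrite !ffunE !inE ffunE inE.
rewrite -(card_imset _ (can_inj (trK I T))).
apply: eq_card => c; rewrite -[c]trK.
rewrite (mem_imset _ _ (can_inj (trK I T))); move: (tr _ _ c) => g {c}.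
rewrite !inE -andbA [RHS]andbCA; congr [&& _, _ & _].
- rewrite ffunE; apply/forallP/eqP => [g0 | /setP g0 i].
    by apply/setP => i; rewrite !inE (negbTE (g0 i)).
  by have := g0 i; rewrite !inE => ->.
- apply/idP/injectiveP => [sep x y | inj].
    rewrite !ffunE => /setP e; apply/eqP/contraT => xy.
    have /existsP[i] := implyP (forallP (forallP sep x) y) xy.
    by have := e i; rewrite !inE => ->; rewrite eqxx.
  apply/forallP => x; apply/forallP => y; apply/implyP; apply: contraNT.
  move/existsPn => e; apply/eqP/inj; rewrite !ffunE; apply/setP => i.
  by rewrite !inE; apply/eqP; have := e i; rewrite negbK.
- apply/forallP/forallP => [inv x | inv i].
    by rewrite inE; apply/forallP => i; rewrite !ffunE !inE (eqP (inv i)).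
  apply/eqP/setP => x; have := inv x; rewrite inE => /forallP/(_ i)/eqP.
  by rewrite !ffunE !inE.
Qed.

(** * From families to injective tuples *)

Lemma card_injections_image (I U : finType) (Q : pred {set U}) :
  #|[set g : {ffun I -> U} | Q (g @: setT) & injectiveb g]|
    = (#|[set F : {set U} | Q F & #|F| == #|I|]| * (#|I|)`!)%N.
Proof.
rewrite -sum1_card (partition_big (fun g : {ffun I -> U} => g @: setT)
  (mem [set F : {set U} | Q F & #|F| == #|I|])) /=; last first.
  move=> g; rewrite !inE => /andP[-> /injectiveP gi].
  by rewrite card_imset ?cardsT /=.
rewrite -sum_nat_const; apply: eq_bigr => F; rewrite inE => /andP[QF /eqP cF].
(* The fibre over [F] consists of the injections into [F]; since [F] has as many elements as [I],
   each of them is onto. *)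
rewrite -ffactnn -{1}cF -(card_inj_ffuns_on I (mem F)) sum1_card.
apply: eq_card => g; rewrite !inE; apply/andP/andP.
  rewrite inE => -[/andP[_ gi] /eqP eF]; split=> //.
  by apply/forallP => i; rewrite /= -eF imset_f ?inE.
move=> [/forallP gF gi].
have eF : g @: setT = F.
  apply/eqP; rewrite eqEcard; apply/andP; split.
    by apply/subsetP => _ /imsetP[i _ ->]; apply: gF.
  by rewrite card_imset ?cardsT ?cF //; apply/injectiveP.
by rewrite inE eF QF gi eqxx.
Qed.

(** * Bipartitions encoded by sets avoiding a base point *)

Section TwoBlocks.
Variable T : finType.

(* Removing set0 makes B = set0 encode the trivial bipartition. *)
Definition two_blocks (B : {set T}) : {set {set T}} := [set B; ~: B] :\ set0.

Lemma mem_two_blocks (A B : {set T}) (x : T) :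
  x \in A -> (A \in two_blocks B) = (A == B) || (A == ~: B).
Proof.
move=> xA; rewrite !inE; case: eqP => // e.
by rewrite e inE in xA.
Qed.

Lemma bipartition_two_blocks (B : {set T}) : bipartition (two_blocks B).
Proof.
apply/andP; split; last first.
  apply: leq_trans (subset_leq_card (subsetDl _ _)) _.
  by rewrite cards2; case: eqP.
apply/and3P; split; last by rewrite !inE eqxx.
  rewrite eqEsubset subsetT /=; apply/subsetP => x _; apply/bigcupP.
  case: (boolP (x \in B)) => xB.
    by exists B; rewrite ?(mem_two_blocks _ xB) ?eqxx.
  have xC : x \in ~: B by rewrite inE.
  by exists (~: B); rewrite ?(mem_two_blocks _ xC) ?eqxx ?orbT.
apply/trivIsetP => A C; rewrite !inE => /andP[_ /orP[]/eqP->] /andP[_ /orP[]/eqP->];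
  rewrite ?eqxx // => _; by rewrite -setI_eq0 ?setICr // setIC setICr.
Qed.

Lemma cuts_two_blocks (B : {set T}) (x y : T) :
  cuts (two_blocks B) x y = ((x \in B) != (y \in B)).
Proof.
apply/existsP/idP.
  case=> A /andP[AP /existsP[C /andP[CP /and3P[AC xA yC]]]].
  move: AP CP AC xA yC; rewrite !inE.
  by move=> /andP[_ /orP[]/eqP->] /andP[_ /orP[]/eqP->];
    rewrite ?eqxx // !inE => _; case: (x \in B); case: (y \in B).
move=> xy; pose A z := if z \in B then B else ~: B.
have zA z : z \in A z by rewrite /A; case: ifP => zB; rewrite ?inE zB.
have AP z : A z \in two_blocks B.
  by rewrite (mem_two_blocks _ (zA z)) /A; case: ifP; rewrite eqxx ?orbT.
exists (A x); rewrite AP; apply/existsP; exists (A y); rewrite AP zA zA !andbT.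
apply: contraNneq xy => e; have := zA y; rewrite -e /A.
by case: ifP => xB; rewrite ?inE; case: (y \in B).
Qed.

(** Take for [B] the complement of the block of [x0]: with at most two blocks, any other block must
    be all of it. *)
Lemma two_blocks_onto (x0 : T) (P : {set {set T}}) :
  bipartition P -> exists2 B : {set T}, x0 \notin B & P = two_blocks B.
Proof.
move=> /andP[partP cP]; have /and3P[/eqP covP trP P0] := partP.
have x0P : x0 \in cover P by rewrite covP inE.
pose A := pblock P x0; have AP : A \in P by apply: pblock_mem.
have x0A : x0 \in A by rewrite mem_pblock.
exists (~: A); first by rewrite inE negbK.
have blockP C : C \in P -> C = A \/ C = ~: A.
  move=> CP; have [-> | CA] := eqVneq C A; [by left | right].
  have disj : [disjoint C & A] := trivIsetP trP C A CP AP CA.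
  apply/eqP; rewrite eqEsubset -disjoints_subset disj /=.
  apply/subsetP => x; rewrite inE => xA.
  have : x \in cover P by rewrite covP inE.
  case/bigcupP => E EP xE.
  have EA : E != A by apply: contraNneq xA => <-.
  suff -> : C = E by [].
  (* Otherwise [A], [C] and [E] would be three distinct blocks. *)
  apply/eqP; apply: contraLR cP => CE; rewrite -ltnNge.
  have sub : [set A; C; E] \subset P.
    by apply/subsetP => Z; rewrite !inE => /orP[/orP[]|] /eqP->.
  apply: leq_trans (subset_leq_card sub).
  by rewrite -setUA cardsU1 cards2 CE !inE negb_or eq_sym CA eq_sym EA.
apply/setP => C; rewrite !inE setCK; apply/idP/andP => [CP | [C0]].
  split; first by apply: contraNneq P0 => <-.
  by case: (blockP C CP) => ->; rewrite eqxx ?orbT.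
case/orP => /eqP e; last by rewrite e.
(* A nonempty complement of [A] is a block: the block of any of its points is not [A]. *)
have [x xC] := set0Pn _ C0.
have : x \in cover P by rewrite covP inE.
case/bigcupP => E EP xE; case: (blockP E EP) => eE; last by rewrite e -eE.
by move: xC; rewrite e inE -eE xE.
Qed.

(** [B] can be recovered as the set of points that its bipartition cuts from [x0]. *)
Lemma two_blocks_inj (x0 : T) :
  {in [pred B : {set T} | x0 \notin B] &, injective two_blocks}.
Proof.
move=> B C /= x0B x0C e; apply/setP => x.
have := cuts_two_blocks B x0 x; rewrite e cuts_two_blocks !inE in x0B x0C *.
by rewrite (negbTE x0B) (negbTE x0C); case: (x \in B); case: (x \in C).
Qed.

(** Taking images under [two_blocks] carries families of sets avoiding [x0] bijectively to families
    of bipartitions, and [cuts_two_blocks] matches the separation conditions. *)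
Lemma tau_sets (x0 : T) (k : nat) :
  tau T k = #|[set F : {set {set T}} |
    [forall B in F, x0 \notin B] &&
    [forall x, forall y,
      (x != y) ==> [exists B in F, (x \in B) != (y \in B)]]
    & #|F| == k]|.
Proof.
set S := [set F | _].
have S_sub F : F \in S -> {in F, forall B : {set T}, x0 \notin B}.
  by rewrite !inE -andbA => /and3P[/forallP h _ _] B BF; apply: (implyP (h B)).
rewrite -(card_in_imset (f := fun F : {set {set T}} => two_blocks @: F) (D := S)).
  apply: eq_card => G; rewrite inE; apply/andP/imsetP.
    case=> /andP[/forallP bG /forallP sG] /eqP cG.
    (* The preimage of [G] among sets avoiding [x0] is the family sought. *)
    have eG : G = two_blocks @: [set B : {set T} | x0 \notin B & two_blocks B \in G].
      apply/setP => P; apply/idP/imsetP => [PG | [B]]; last first.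
        by rewrite inE => /andP[_ ?] ->.
      have [B xB eP] := two_blocks_onto x0 (implyP (bG P) PG).
      by exists B; rewrite // inE xB -eP.
    exists [set B : {set T} | x0 \notin B & two_blocks B \in G] => //.
    rewrite inE; apply/andP; split; last first.
      rewrite -cG {2}eG card_in_imset // => B C; rewrite !inE.
      by move=> /andP[xB _] /andP[xC _]; apply: (@two_blocks_inj x0).
    apply/andP; split.
      by apply/forallP => B; apply/implyP; rewrite inE => /andP[].
    apply/forallP => x; apply/forallP => y; apply/implyP => xy.
    have /existsP[P /andP[]] := implyP (forallP (sG x) y) xy.
    rewrite {1}eG => /imsetP[B BG ->]; rewrite cuts_two_blocks => cB.
    by apply/existsP; exists B; rewrite BG.
  case=> F FS ->; have := FS; rewrite inE => /andP[/andP[_ sF] /eqP cF].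
  split; last first.
    rewrite card_in_imset ?cF // => B C BF CF.
    by apply: (@two_blocks_inj x0); apply: S_sub FS _ _.
  apply/andP; split.
    apply/forallP => P; apply/implyP => /imsetP[B _ ->].
    exact: bipartition_two_blocks.
  apply/forallP => x; apply/forallP => y; apply/implyP => xy.
  have /existsP[B /andP[BF cB]] := implyP (forallP (forallP sF x) y) xy.
  by apply/existsP; exists (two_blocks B); rewrite imset_f // cuts_two_blocks.
have sub F G : F \in S -> G \in S ->
    two_blocks @: F = two_blocks @: G -> F \subset G.
  move=> FS GS e; apply/subsetP => B BF.
  have : two_blocks B \in two_blocks @: G by rewrite -e imset_f.
  case/imsetP => C CG eBC; suff -> : B = C by [].
  by apply: (@two_blocks_inj x0) eBC; [apply: S_sub FS _ _ | apply: S_sub GS _ _].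
by move=> F G FS GS e; apply/eqP; rewrite eqEsubset !sub.
Qed.

End TwoBlocks.

(** * Assembling the formula *)

Lemma tau_fact (T : finType) (x0 : T) (k : nat) :
  (tau T k * k`!)%N =
  #|[set g : {ffun 'I_k -> {set T}} |
      [forall i, x0 \notin g i] && separates g & injectiveb g]|.
Proof.
rewrite (tau_sets x0).
have := card_injections_image 'I_k (fun F : {set {set T}} =>
  [forall B in F, x0 \notin B] &&
  [forall x, forall y,
      (x != y) ==> [exists B in F, (x \in B) != (y \in B)]]).
rewrite card_ord => <-; apply: eq_card => g; rewrite !inE; congr [&& _ & _]; congr [&& _ & _].
  apply/forallP/forallP => h i; last first.
    by apply/implyP => /imsetP[j _ ->].
  by apply: (implyP (h _)); rewrite imset_f ?inE.
apply: eq_forallb => x; apply: eq_forallb => y; congr (_ ==> _).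
apply/existsP/existsP => [[B /andP[/imsetP[i _ ->] h]] | [i h]].
  by exists i.
by exists (g i); rewrite imset_f ?inE.
Qed.

Lemma sum_by_cycle_count (R : pzRingType) (k : nat) (F : nat -> R) :
  (0 < k)%N ->
  \sum_(s : 'S_k) (-1) ^+ s * F #|porbits s| =
  \sum_(1 <= i < k.+1) (-1) ^+ (k - i)%N * (stirling1 k i)%:R * F i.
Proof.
move=> k_gt0.
have orb_bounds (s : 'S_k) : (0 < #|porbits s| < k.+1)%N.
  rewrite card_gt0 ltnS; apply/andP; split.
    by apply/set0Pn; exists (porbit s (Ordinal k_gt0)); apply: imset_f.
  by apply: leq_trans (leq_imset_card _ _) _; rewrite card_ord.
(* Cycle counts go into a finite type for [partition_big]; by [orb_bounds] the default of [inord]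
   never occurs. *)
pose p (s : 'S_k) : 'I_k.+1 := inord #|porbits s|.
have pE s : p s = #|porbits s| :> nat.
  by rewrite inordK //; case/andP: (orb_bounds s).
rewrite (partition_big p (fun i => 0 < i)%N) /=; last first.
  by move=> s _; rewrite pE; case/andP: (orb_bounds s).
rewrite big_geq_mkord /=; apply: eq_bigr => i _.
rewrite -mulrA mulr_natl mulrnAr /stirling1 -sumr_const.
apply: eq_big => [s | s /eqP <-]; first by rewrite inE -val_eqE /= pE.
(* The parity of [s] is by definition that of [k] plus its number of cycles; the truncated
   difference has this parity because that number is at most [k]. *)
rewrite pE /odd_perm card_ord; congr (_ * _).
rewrite -[RHS]signr_odd oddB //.
by case/andP: (orb_bounds s).
Qed.

Theorem theorem3p8 (n k : nat) (T : finType) (hT : #|T| = n)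
    (hn : (2 <= n)%N) (hk1 : (1 <= k)%N) (hk2 : (k <= 2 ^ (n - 1))%N) :
  (tau T k)%:R =
    ((n - 1)`!)%:R / (k`!)%:R *
    \sum_(1 <= i < k.+1)
      (-1) ^+ (k - i)%N * (stirling1 k i)%:R * 'C((2 ^ i - 1)%N, (n - 1)%N)%:R
  :> rat.
Proof.
have /card_gt0P[x0 _] : (0 < #|T|)%N by rewrite hT (leq_trans _ hn).
have k_neq0 : (k`!)%:R != 0 :> rat by rewrite Num.Theory.pnatr_eq0 -lt0n fact_gt0.
apply: (mulIf k_neq0).
rewrite -natrM (tau_fact x0) card_injective_signed mulrAC divfK //.
(* The falling factorial becomes a binomial coefficient times [(n - 1)!], a factor common to all
   cycle counts. *)
under eq_bigr => s _ do rewrite card_separating_invariant hT -!subn1 -bin_ffact.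
rewrite (sum_by_cycle_count
  (fun i => ('C(2 ^ i - 1, n - 1) * (n - 1)`!)%:R) hk1) mulr_sumr.
by apply: eq_bigr => i _; rewrite natrM mulrA mulrC.
Qed.
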